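(* Let $A\geq a\geq 1$ and $r\geq 2$ be integers, and let $N\overline{mes}_{r,A,a}$ be the set of overpartitions $\pi$ having fewer than $r-1$ non-overlined parts equal to $\overline{mes}_{r,A,a}(\pi)$. Then \[ \sum_{\pi\in N\overline{mes}_{r,A,a}}z^{\overline{mes}_{r,A,a}(\pi)}q^{|\pi|}=\frac{(-q;q)_{\infty}}{(q;q)_{\infty}}\sum_{k=0}^{\infty}z^{kA+a}\bigg[\frac{q^{r[A\binom{k}{2}+ka]}}{(-q^{a};q^{A})_{k}}-\frac{q^{r[A\binom{k}{2}+ka]+(r-1)(kA+a)}}{(-q^{a};q^{A})_{k}}\bigg]. \]
   Context: An overpartition is a partition (finite non-increasing sequence of positive integers) in which the first occurrence of each part value may be overlined; $|\pi|$ is the sum of parts. $(a;q)_\infty=\prod_{i\geq0}(1-aq^i)$, $(a;q)_n=(a;q)_\infty/(aq^n;q)_\infty$; $|q|<1$, $z$ a formal variable. For $r\geq2$, $\overline{mes}_{r,A,a}(\pi)$ is the smallest positive integer $m\equiv a\pmod A$ such that either $\pi$ has no overlined part $\overline{m}$ or $\pi$ has fewer than $r-1$ non-overlined parts equal to $m$. *)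

(* Defs.v *)
From HB Require Import structures.
From mathcomp Require Import all_boot all_order all_algebra complex finmap.
From mathcomp Require Import all_classical all_reals all_analysis.
From mathcomp Require Import showcase.summability.
Set Implicit Arguments.
Unset Strict Implicit.
Unset Printing Implicit Defensive.
Import Order.TTheory GRing.Theory Num.Theory.
Import numFieldNormedType.Exports.

Local Open Scope classical_set_scope.
Local Open Scope ring_scope.

(* A part is a pair (value, overlined?).  The last conjunct says that a part
   preceded by a part of the same value is not overlined, i.e. only the first
   occurrence of each value may be overlined. *)
Definition is_overpartition (s : seq (nat * bool)) : bool :=
  [&& all (fun x => 0 < x.1)%N s,
      sorted geq [seq x.1 | x <- s] &
      pairwise (fun x y => (x.1 == y.1) ==> ~~ y.2) s].

Record overpartition := Overpartition {
  parts :> seq (nat * bool);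
  _ : is_overpartition parts }.

HB.instance Definition _ := [isSub for parts].
HB.instance Definition _ := [Choice of overpartition by <:].

Definition weight (p : overpartition) : nat := sumn [seq x.1 | x <- parts p].

Definition has_overlined (p : overpartition) (m : nat) : bool :=
  (m, true) \in parts p.

Definition num_nonoverlined (p : overpartition) (m : nat) : nat :=
  count_mem (m, false) (parts p).

Definition mes_cond (r A a : nat) (p : overpartition) (m : nat) : Prop :=
  [/\ (0 < m)%N, m = a %[mod A] &
      ~~ has_overlined p m \/ (num_nonoverlined p m < r.-1)%N].

(* The default 0 is never taken when 0 < A, see [mesP]. *)
Definition mes (r A a : nat) (p : overpartition) : nat :=
  xget 0%N [set m | mes_cond r A a p m /\
                    forall n, mes_cond r A a p n -> (m <= n)%N].

Lemma mesP (r A a : nat) (p : overpartition) : (0 < A)%N ->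
  mes_cond r A a p (mes r A a p) /\
  forall n, mes_cond r A a p n -> (mes r A a p <= n)%N.
Proof.
move=> A0.
have ex : exists m, `[< mes_cond r A a p m >].
  exists (A * (weight p).+1 + a)%N; apply/asboolP; split.
  - by rewrite addn_gt0 muln_gt0 A0.
  - by rewrite mulnC modnMDl.
  - left; apply/negP => mp.
    have /(_ _ mp) : forall x, x \in parts p -> (x.1 <= weight p)%N.
      rewrite /weight; elim: (parts p) => //= y s IH x; rewrite inE => /orP[/eqP->|/IH h].
        exact: leq_addr.
      exact: leq_trans h (leq_addl _ _).
    rewrite /= leqNgt => /negP; apply.
    exact: leq_trans (leq_trans (leq_pmull _ A0) (leq_addr _ _)).
apply: (@xgetPex _ 0%N
  [set m | mes_cond r A a p m /\ forall n, mes_cond r A a p n -> (m <= n)%N]).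
have [m /asboolP Hm Hmin] := ex_minnP ex.
by exists m; split => // n Hn; apply/Hmin/asboolP.
Qed.

Definition Nmes (r A a : nat) : set overpartition :=
  [set p | (num_nonoverlined p (mes r A a p) < r.-1)%N].

Section QSeries.
Variable K : numFieldType.

Definition qpoch_inf (a q : K) : K :=
  lim (\prod_(0 <= i < n) (1 - a * q ^+ i) @[n --> \oo]).

Definition qpoch (a q : K) (n : nat) : K :=
  qpoch_inf a q / qpoch_inf (a * q ^+ n) q.

(* A formal series in z over K is represented by its coefficient function
   nat -> K.  For a family of monomials c i * z ^ e i indexed by i in D,
   [zcoef D e c m] is the coefficient of z ^ m in its sum: the unordered sum
   (limit along the finite subsets of I) of the c i with i in D and e i = m. *)
Definition zterm (I : choiceType) (D : set I) (e : I -> nat) (c : I -> K)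
    (m : nat) : I -> K :=
  fun i => if (i \in D) && (e i == m) then c i else 0.

Definition zcoef (I : choiceType) (D : set I) (e : I -> nat) (c : I -> K)
    (m : nat) : K :=
  summability.sum (zterm D e c m).

Definition zconvergent (I : choiceType) (D : set I) (e : I -> nat)
    (c : I -> K) : Prop :=
  forall m, cvg (partial_sum (zterm D e c m) @ totally).

End QSeries.

(* Main.v *)
Require Import Defs.
From mathcomp Require Import all_boot all_order all_algebra complex finmap.
From mathcomp Require Import all_classical all_reals all_analysis.
From mathcomp Require Import showcase.summability.
From mathcomp Require Import ring zify.
Import Order.TTheory GRing.Theory Num.Theory.
Import numFieldNormedType.Exports.
Local Open Scope classical_set_scope.
Local Open Scope ring_scope.
Local Open Scope complex_scope.

Set Implicit Arguments.
Unset Strict Implicit.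
Unset Printing Implicit Defensive.

(* An overpartition amounts to a choice, for each part size n, of an overlining
   bit b and a number j of non-overlined copies, so the sum over those with
   parts and multiplicities at most N is a finite product over n <= N.
   Write m_i = i A + a.  An overpartition lies in Nmes with mes = m_k exactly
   when both \overline{m_i} and at least r-1 plain copies of m_i occur for all
   i < k, and fewer than r-1 plain copies of m_k occur.  These conditions are local:
   they multiply the factor (1 + q^n) / (1 - q^n) of the full generating function
   by q^(r n) / (1 + q^n) for n = m_0, ..., m_(k-1) and by 1 - q^((r-1) n) for
   n = m_k.  Absolute convergence comes from the same product at |q|. *)

(** * Convergence of infinite products and of q-Pochhammer symbols *)

Section InfiniteProducts.
Variable K : numFieldType.

(* Besides completeness this encodes the Archimedean property: it makes [x ^+ n]
   tend to 0, which fails in a general ordered field. *)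
Definition geom_complete : Prop :=
  forall (C x : K) (u : nat -> K), 0 <= x -> x < 1 ->
    (forall n, `|u n.+1 - u n| <= C * x ^+ n) ->
    exists l : K, u n @[n --> \oo] --> l.

Hypothesis Kcomplete : geom_complete.

(** The increments have absolute value (1 - x) x^n, so a limit l exists; shifting the index gives l
    = x l, hence l = 0. *)
Lemma cvg_exp_ge0 (x : K) : 0 <= x -> x < 1 -> x ^+ n @[n --> \oo] --> (0 : K).
Proof.
move=> x0 x1.
have [l xl] : exists l : K, x ^+ n @[n --> \oo] --> l.
  apply: (@Kcomplete (1 - x) x) => // n.
  rewrite exprS -[X in _ - X]mul1r -mulrBl normrM distrC.
  by rewrite !ger0_norm ?exprn_ge0// subr_ge0 ltW.
have xl' : x ^+ n.+1 @[n --> \oo] --> l by rewrite -cvg_shiftS in xl.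
have xl2 : x ^+ n.+1 @[n --> \oo] --> x * l.
  by under eq_cvg do rewrite exprS; apply: cvgMr xl.
have /eqP : l = x * l by exact: norm_cvg_unique xl' xl2.
rewrite -subr_eq0 -[X in X - _]mul1r -mulrBl.
by rewrite mulf_eq0 subr_eq0 gt_eqF//= => /eqP l0; rewrite -l0.
Qed.

Lemma cvg_exp (x : K) : `|x| < 1 -> x ^+ n @[n --> \oo] --> (0 : K).
Proof.
move=> x1; apply/norm_cvg0P; under eq_cvg do rewrite normrX.
exact: cvg_exp_ge0.
Qed.

(* The products [P n] satisfy [P n * x ^+ n = O((x + d) ^+ n)] with [x + d < 1], so
   their increments [C * x ^+ n * P n] decay geometrically and they converge. *)
Lemma prod_geom_bounded (C x : K) : 0 <= C -> 0 <= x -> x < 1 ->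
  exists B, forall n, \prod_(0 <= i < n) (1 + C * x ^+ i) <= B.
Proof.
move=> C0 x0 x1.
pose P n : K := \prod_(0 <= i < n) (1 + C * x ^+ i).
have PS n : P n.+1 = P n * (1 + C * x ^+ n) by rewrite /P big_nat_recr.
have P0 n : 0 <= P n.
  by apply: prodr_ge0 => i _; rewrite addr_ge0// mulr_ge0// exprn_ge0.
have leP n m : (n <= m)%N -> P n <= P m.
  move=> /subnK <-; elim: (m - n)%N => // k IH; rewrite addSn PS.
  by apply: (le_trans IH); rewrite ler_peMr// lerDl mulr_ge0// exprn_ge0.
(* Half the gap below 1: x + d = (1 + x) / 2. *)
pose d : K := (1 - x) / 2.
have d0 : 0 < d by rewrite divr_gt0// subr_gt0.
have xd : x + d < 1 by rewrite -ltrBrDl /d ltr_pdivrMr// mulr_natr mulr2n ltrDl subr_gt0.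
have [N _ HN] : \forall n \near \oo, `|C * x ^+ n| < d.
  have : C * x ^+ n @[n --> \oo] --> C * 0 by apply: cvgMr; exact: cvg_exp_ge0.
  by rewrite mulr0 => /cvgr0Pnorm_lt; apply.
(* From rank N on, passing from P n * x^n to the next term multiplies by x + C x^n x <= x + d. *)
have growth k : P (k + N)%N * x ^+ (k + N) <= P N * x ^+ N * (x + d) ^+ k.
  elim: k => [|k IH]; first by rewrite expr0 mulr1.
  rewrite addSn PS [x ^+ _.+1]exprS [(_ + _) ^+ _.+1]exprSr !mulrA.
  have -> : P (k + N)%N * (1 + C * x ^+ (k + N)) * x * x ^+ (k + N) =
    P (k + N)%N * x ^+ (k + N) * (x + C * x ^+ (k + N) * x) by ring.
  apply: ler_pM => //; first by rewrite mulr_ge0// exprn_ge0.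
    by rewrite addr_ge0// !mulr_ge0// exprn_ge0.
  rewrite lerD2l; have := HN (k + N)%N (leq_addl _ _).
  rewrite ger0_norm ?mulr_ge0 ?exprn_ge0// => /ltW; apply: le_trans.
  by rewrite ler_piMr ?mulr_ge0 ?exprn_ge0// ltW.
have [l Pl] : exists l : K, (fun k => P (k + N)%N) n @[n --> \oo] --> l.
  apply: (@Kcomplete (C * (P N * x ^+ N)) (x + d)) => [||n] //.
    by rewrite addr_ge0// ltW.
  rewrite addSn PS mulrDr mulr1 addrAC subrr add0r ger0_norm; last first.
    by rewrite !mulr_ge0// exprn_ge0.
  by rewrite mulrCA -mulrA ler_wpM2l.
have {}Pl : P n @[n --> \oo] --> l by rewrite -(cvg_shiftn N).
(* As P is nondecreasing, P n is at most a later term lying within 1 of the limit. *)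
exists (`|l| + 1) => n; have [M _ HM] : \forall n \near \oo, `|l - P n| < 1.
  by move/cvgrPdist_lt: Pl; apply.
apply: (@le_trans _ _ (P (maxn n M))); first exact/leP/leq_maxl.
have := HM (maxn n M) (leq_maxr _ _).
rewrite distrC -[X in X <= _]ger0_norm// => /ltW h.
by rewrite -lerBlDl; apply: le_trans h; rewrite lerB_dist.
Qed.

Lemma norm_prod1D_le (I : Type) (s : seq I) (u v : I -> K) :
  (forall i, `|u i| <= v i) ->
  `|\prod_(i <- s) (1 + u i)| <= \prod_(i <- s) (1 + v i).
Proof.
move=> uv; rewrite normr_prod ler_prod// => i _; rewrite normr_ge0/=.
by rewrite (le_trans (ler_normD _ _))// normr1 lerD2l.
Qed.

(** The n-th increment is the partial product times u n. The partial products are bounded by some B,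
    so the increments are at most B C x^n. *)
Lemma cvg_prod1D (C x : K) (u : nat -> K) : 0 <= x -> x < 1 ->
  (forall i, `|u i| <= C * x ^+ i) ->
  exists l : K, \prod_(0 <= i < n) (1 + u i) @[n --> \oo] --> l.
Proof.
move=> x0 x1 uC.
have C0 : 0 <= C by have := uC 0; rewrite expr0 mulr1; apply: le_trans.
have [B HB] := prod_geom_bounded C0 x0 x1.
apply: (@Kcomplete (B * C) x) => // n.
rewrite big_nat_recr//= mulrDr mulr1 addrAC subrr add0r normrM -mulrA ler_pM//.
exact: le_trans (norm_prod1D_le _ uC) (HB n).
Qed.

(* The reciprocal product has factors [1 - u i / (1 + u i)], hence converges as
   well, and the two limits multiply to 1. *)
Lemma cvg_prod1D_neq0 (C x c : K) (u : nat -> K) : 0 <= x -> x < 1 -> 0 < c ->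
  (forall i, `|u i| <= C * x ^+ i) -> (forall i, c <= `|1 + u i|) ->
  exists2 l : K, l != 0 & \prod_(0 <= i < n) (1 + u i) @[n --> \oo] --> l.
Proof.
move=> x0 x1 c0 uC uc.
have [l hl] := cvg_prod1D x0 x1 uC.
have nz i : 1 + u i != 0 by rewrite -normr_gt0 (lt_le_trans c0).
have [l' hl'] : exists l : K,
    \prod_(0 <= i < n) (1 + (- u i / (1 + u i))) @[n --> \oo] --> l.
  apply: (@cvg_prod1D (C / c) x) => // i.
  rewrite normrM normrN normfV mulrAC ler_pM// lef_pV2 ?uc// posrE//.
  exact: lt_le_trans c0 (uc i).
exists l => //; apply/eqP => l0.
have : \prod_(0 <= i < n) (1 + u i) *
    \prod_(0 <= i < n) (1 + (- u i / (1 + u i))) @[n --> \oo] --> l * l'.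
  exact: cvgM.
have -> : (fun n => \prod_(0 <= i < n) (1 + u i) *
    \prod_(0 <= i < n) (1 + (- u i / (1 + u i)))) = fun=> 1.
  apply/funext => n; rewrite -big_split/= big1// => i _.
  by rewrite mulrDr mulr1 mulrCA divff// mulr1 addrK.
rewrite l0 mul0r => h.
have /eqP : 0 = 1 :> K by apply: norm_cvg_unique h _; exact: cvg_cst.
by rewrite eq_sym oner_eq0.
Qed.

(** Each factor satisfies |1 - b q^i| >= 1 - |b| > 0, the lower bound needed for a nonzero limit. In
    particular the [lim] in [qpoch_inf] is a genuine limit. *)
Lemma cvg_qpoch_inf (b q : K) : `|b| < 1 -> `|q| < 1 ->
  qpoch_inf b q != 0 /\
  \prod_(0 <= i < n) (1 - b * q ^+ i) @[n --> \oo] --> qpoch_inf b q.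
Proof.
move=> b1 q1.
have [|i|i|l l0 hl] := @cvg_prod1D_neq0 `|b| `|q| (1 - `|b|)
    (fun i => - (b * q ^+ i)) (normr_ge0 _) q1.
- by rewrite subr_gt0.
- by rewrite normrN normrM normrX.
- rewrite -{1}(normr1 K); apply: le_trans (lerB_dist _ _).
  by rewrite normrM normrX lerD2l lerN2 ler_piMr// exprn_ile1// ltW.
rewrite /qpoch_inf; have -> // : lim (\prod_(0 <= i < n) (1 - b * q ^+ i) @[n --> \oo]) = l.
exact: norm_cvg_lim hl.
Qed.

(** Splitting the infinite product after its first k factors leaves the product started at b q^k,
    which is nonzero and can be divided out. *)
Lemma qpochE (b q : K) k : `|b| < 1 -> `|q| < 1 ->
  qpoch b q k = \prod_(0 <= i < k) (1 - b * q ^+ i).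
Proof.
move=> b1 q1; have bq1 : `|b * q ^+ k| < 1.
  rewrite normrM normrX (le_lt_trans _ b1)// ler_piMr// exprn_ile1//.
  exact: ltW.
have [_ hb] := cvg_qpoch_inf b1 q1; have [nz hbq] := cvg_qpoch_inf bq1 q1.
rewrite /qpoch; apply: (canLR (mulfK nz)).
have e n : \prod_(0 <= i < n + k) (1 - b * q ^+ i) =
    \prod_(0 <= i < k) (1 - b * q ^+ i) *
    \prod_(0 <= i < n) (1 - b * q ^+ k * q ^+ i).
  rewrite (big_cat_nat (n := k)) ?leq_addl//=; congr (_ * _).
  rewrite -{1}(add0n k) big_addn addnK; apply: eq_bigr => i _.
  by rewrite addnC exprD mulrA.
have hb' : \prod_(0 <= i < n + k) (1 - b * q ^+ i) @[n --> \oo] --> qpoch_inf b q.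
  by rewrite -(cvg_shiftn k) in hb.
apply: (norm_cvg_unique hb'); rewrite /mkset.
by under eq_cvg do rewrite e; exact: cvgMr hbq.
Qed.

(** Expanded in t, the left side has nonnegative coefficients and no constant term, and t^j <= t for
    j >= 1. *)
Lemma prod1D_scale_le (I : Type) (s : seq I) (t : K) (v : I -> K) :
  0 <= t -> t <= 1 -> (forall i, 0 <= v i) ->
  \prod_(i <- s) (1 + t * v i) - 1 <= t * (\prod_(i <- s) (1 + v i) - 1).
Proof.
move=> t0 t1 v0; elim: s => [|i s IH]; first by rewrite !big_nil subrr mulr0.
rewrite !big_cons; set P := \prod_(i <- s) (1 + v i) in IH *.
have P1 : 0 <= P - 1.
  rewrite subr_ge0 /P; elim: s {P IH} => [|j s IH]; first by rewrite big_nil.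
  by rewrite big_cons -[X in X <= _]mulr1 ler_pM// ?ler01// lerDl.
rewrite lerBlDr in IH.
rewrite lerBlDr; apply: (@le_trans _ _ ((1 + t * v i) * (t * (P - 1) + 1))).
  by rewrite ler_wpM2l// addr_ge0// mulr_ge0.
rewrite -subr_ge0 (_ : _ - _ = (1 - t) * (t * (v i * (P - 1)))); last by ring.
by rewrite !mulr_ge0// subr_ge0.
Qed.

Lemma dist_prod1D_le (I : Type) (s : seq I) (u : I -> K) :
  `|\prod_(i <- s) (1 + u i) - 1| <= \prod_(i <- s) (1 + `|u i|) - 1.
Proof.
elim: s => [|i s IH]; first by rewrite !big_nil subrr normr0.
rewrite !big_cons !mulrDl !mul1r ![_ + _ * _ - 1]addrAC.
rewrite (le_trans (ler_normD _ _))// lerD// normrM ler_wpM2l//.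
exact: norm_prod1D_le.
Qed.

(** This product collects the numerators 1 - x^(n+1) of the geometric sums cut at exponent n, with x
    = q^(i+1). Its distance to 1 is at most |q|^n B, because (i + 1)(n + 1) >= n + i lets a factor
    |q|^n be extracted from every term. *)
Lemma cvg_prod_truncation (q : K) : `|q| < 1 ->
  \prod_(0 <= i < n) (1 - (q ^+ i.+1) ^+ n.+1) @[n --> \oo] --> (1 : K).
Proof.
move=> q1; have [B HB] := prod_geom_bounded ler01 (normr_ge0 q) q1.
apply/subr_cvg0/cvgr0Pnorm_lt => e e0.
have B1 : 0 < B.
  by apply: lt_le_trans (HB 0); rewrite big_nil.
have : `|q| ^+ n * B @[n --> \oo] --> 0 * B.
  by apply: cvgMl; exact: cvg_exp_ge0.
rewrite mul0r => /cvgr0Pnorm_lt /(_ _ e0); apply: filterS => n; apply: le_lt_trans.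
rewrite [X in _ <= X]ger0_norm ?mulr_ge0 ?exprn_ge0 ?(ltW B1)//.
apply: (le_trans (dist_prod1D_le _ _)).
apply: (@le_trans _ _ (\prod_(0 <= i < n) (1 + `|q| ^+ n * (1 * `|q| ^+ i)) - 1)).
  rewrite lerD2r ler_prod// => i _; rewrite addr_ge0//= lerD2l.
  rewrite normrN !normrX -exprM mul1r -exprD ler_wiXn2l ?(ltW q1)//.
  by rewrite mulnS addSn mulSn; lia.
apply: le_trans (prod1D_scale_le _ _ _ _) _ => [||i|].
- by rewrite exprn_ge0.
- by rewrite exprn_ile1// ltW.
- by rewrite mul1r exprn_ge0.
rewrite ler_wpM2l ?exprn_ge0// (le_trans _ (HB n))// gerDl oppr_le0 ler01//.
Qed.

Lemma cvg_prod_seq (J : Type) (s : seq J) (f : nat -> J -> K) (l : J -> K) :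
  (forall j, f n j @[n --> \oo] --> l j) ->
  \prod_(j <- s) f n j @[n --> \oo] --> \prod_(j <- s) l j.
Proof.
move=> fl; elim: s => [|j s IH].
  by rewrite big_nil; under eq_cvg do rewrite big_nil; exact: cvg_cst.
by rewrite big_cons; under eq_cvg do rewrite big_cons; exact: cvgM.
Qed.

Lemma norm_lt1_subr_neq0 (x : K) : `|x| < 1 -> 1 - x != 0.
Proof.
by apply: contraTneq => /eqP; rewrite subr_eq0 => /eqP <-; rewrite normr1 ltxx.
Qed.

Lemma geom_sumE (x : K) n : `|x| < 1 ->
  \sum_(0 <= i < n) x ^+ i = (1 - x ^+ n) / (1 - x).
Proof.
move=> /norm_lt1_subr_neq0 nz; apply: (canRL (mulfK nz)).
by rewrite mulrC big_mkord -opprB mulNr -subrX1 opprB.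
Qed.

Lemma cvg_geom_sum (x : K) : `|x| < 1 ->
  \sum_(0 <= i < n) x ^+ i @[n --> \oo] --> (1 - x)^-1.
Proof.
move=> x1.
have : (1 - x ^+ n) / (1 - x) @[n --> \oo] --> (1 - 0) / (1 - x).
  by apply: cvgMl; apply: cvgB; [exact: cvg_cst|exact: cvg_exp].
by rewrite subr0 mul1r; under eq_cvg do rewrite -geom_sumE//.
Qed.

End InfiniteProducts.

(** * Overpartitions described by their multiplicities *)

Lemma overpartition_pairwise (s : seq (nat * bool)) :
  is_overpartition s = all (fun x => 0 < x.1)%N s &&
    pairwise (fun x y => (y.1 <= x.1)%N && ((x.1 == y.1) ==> ~~ y.2)) s.
Proof.
rewrite /is_overpartition; congr (_ && _).
rewrite sorted_pairwise; last by move=> x y z /= yx xz; exact: leq_trans xz yx.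
by rewrite pairwise_map -pairwise_relI.
Qed.

(** A second overlined copy would follow a part of the same value, which is forbidden. *)
Lemma count_overlined (p : overpartition) n :
  count_mem (n, true) (parts p) = has_overlined p n.
Proof.
rewrite /has_overlined; case: p => s /=; rewrite overpartition_pairwise => /andP[_].
elim: s => //= x s IH /andP[/allP xs /IH ->]; rewrite inE [_ == x]eq_sym.
case: eqVneq xs => //= -> xs; rewrite (_ : _ \in s = false)//.
by apply/negP => /xs /=; rewrite eqxx andbF.
Qed.

(* Only the first copy of a value may be overlined, so an overpartition is a
   list sorted for a total order and is determined by its multiplicities. *)
Lemma overpartition_eq (p p' : overpartition) :
  (forall n, (0 < n)%N -> has_overlined p n = has_overlined p' n) ->
  (forall n, (0 < n)%N -> num_nonoverlined p n = num_nonoverlined p' n) ->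
  p = p'.
Proof.
move=> ov num; apply: val_inj => /=.
(* Values decrease, and among equal values the overlined copy comes first. *)
pose le : rel (nat * bool) := fun x y =>
  (y.1 <= x.1)%N && ((x.1 == y.1) ==> (y.2 ==> x.2)).
have ltr : transitive le.
  move=> [y b] [x c] [z d]; rewrite /le/= => /andP[yx h1] /andP[zy h2].
  rewrite (leq_trans zy yx)/=; apply/implyP => /eqP xz; subst z.
  have xy : x = y by apply/eqP; rewrite eqn_leq zy.
  by subst y; move: h1 h2; rewrite eqxx/=; case: b c d => [] [] [].
have las : antisymmetric le.
  move=> [x b] [y c]; rewrite /le/= => /andP[/andP[yx h1] /andP[xy h2]].
  have e : x = y by apply/eqP; rewrite eqn_leq xy.
  by subst y; move: h1 h2; rewrite eqxx/=; case: b c => [] [].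
have srt (t : overpartition) : sorted le (parts t).
  case: t => s /=; rewrite overpartition_pairwise => /andP[_] hs.
  rewrite sorted_pairwise//; apply: sub_pairwise hs => x y /andP[xy h].
  by rewrite /le xy/=; case: eqVneq h => //= _ /negbTE ->.
(* The hypotheses only concern n > 0; the value 0 never occurs as a part. *)
have pos (t : overpartition) b : count_mem (0%N, b) (parts t) = 0%N.
  case: t => s /= /and3P[/allP s0 _ _]; apply/eqP.
  by rewrite -leqn0 leqNgt -has_count has_pred1; apply/negP => /s0.
apply: (sorted_eq ltr las (srt p) (srt p')); apply/permP => P.
suff /permP : perm_eq (parts p) (parts p') by exact.
apply/allP => -[[|n] b] _ /=; first by rewrite !pos.
by case: b; [rewrite !count_overlined ov|rewrite -!/(num_nonoverlined _ _) num].
Qed.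

Definition block (n : nat) (c : bool * nat) : seq (nat * bool) :=
  nseq c.1 (n, true) ++ nseq c.2 (n, false).

(** Blocks are concatenated from the largest value down, each with its overlined copy in front, so
    the list is already an overpartition. *)
Fixpoint blocks (f : nat -> bool * nat) (N : nat) : seq (nat * bool) :=
  if N is n.+1 then block N (f N) ++ blocks f n else [::].

Lemma mem_block n c x : x \in block n c -> x.1 = n.
Proof. by rewrite mem_cat !mem_nseq => /orP[] /andP[_ /eqP ->]. Qed.

Lemma mem_blocks f N x : x \in blocks f N -> (0 < x.1 <= N)%N.
Proof.
elim: N => //= N IH; rewrite mem_cat => /orP[/mem_block ->|/IH]; first by rewrite leqnn.
by move=> /andP[-> /leqW].
Qed.

Lemma blocks_overpartition f N : is_overpartition (blocks f N).
Proof.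
rewrite overpartition_pairwise; apply/andP; split.
  by apply/allP => x /mem_blocks /andP[].
elim: N => //= N IH; rewrite pairwise_cat IH andbT; apply/andP; split.
  apply/allrelP => x y /mem_block -> /mem_blocks /andP[_ yN].
  by rewrite leqW//=; case: eqVneq yN => //= <-; rewrite ltnn.
rewrite pairwise_cat; apply/and3P; split.
- by apply/allrelP => x y /nseqP[-> _] /nseqP[-> _]; rewrite /= leqnn eqxx.
- by case: (f N.+1).1.
- by elim: (f N.+1).2 => //= j ->; rewrite andbT; apply/allP => y /nseqP[-> _]; rewrite /= leqnn eqxx.
Qed.

Definition overpartition_of f N := Overpartition (blocks_overpartition f N).

Lemma count_block n c m b :
  count_mem (m, b) (block n c) = ((m == n) * (if b then c.1 : nat else c.2))%N.
Proof.
rewrite count_cat !count_nseq /= !xpair_eqE ![n == m]eq_sym.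
by case: eqVneq; case: b => //=; rewrite ?mul0n ?mul1n ?addn0.
Qed.

Lemma count_blocks f N m b : (0 < m)%N ->
  count_mem (m, b) (blocks f N) =
  if (m <= N)%N then (if b then (f m).1 : nat else (f m).2) else 0%N.
Proof.
move=> m0; elim: N => [|N IH] /=; first by rewrite leqNgt m0.
rewrite count_cat count_block IH [(m <= N.+1)%N]leq_eqVlt ltnS.
by case: eqVneq => [->|_] /=; rewrite ?mul1n ?mul0n ?ltnn ?addn0.
Qed.

Lemma overpartition_of_num f N m : (0 < m)%N ->
  num_nonoverlined (overpartition_of f N) m = if (m <= N)%N then (f m).2 else 0%N.
Proof. exact: (@count_blocks f N m false). Qed.

Lemma overpartition_of_ov f N m : (0 < m)%N ->
  has_overlined (overpartition_of f N) m = (m <= N)%N && (f m).1.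
Proof.
move=> /(@count_blocks f N m true); rewrite (@count_overlined (overpartition_of f N)).
by case: has_overlined; case: leqP => //= _; case: (f m).1.
Qed.

Lemma overpartition_of_weight f N :
  weight (overpartition_of f N) =
  (\sum_(0 <= i < N) i.+1 * ((f i.+1).1 + (f i.+1).2))%N.
Proof.
rewrite /weight /=; elim: N => [|N IH]; first by rewrite big_geq.
rewrite big_nat_recr//= map_cat sumn_cat IH addnC; congr addn.
by rewrite map_cat sumn_cat !map_nseq !sumn_nseq mulnDr.
Qed.

(** No part exceeds the weight, so the values up to N account for all parts. *)
Lemma overpartition_ofE (p : overpartition) N : (weight p <= N)%N ->
  p = overpartition_of (fun n => (has_overlined p n, num_nonoverlined p n)) N.
Proof.
move=> pN; have big x : x \in parts p -> (x.1 <= N)%N.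
  move=> xp; apply: leq_trans pN; rewrite /weight.
  by rewrite (perm_sumn (perm_map _ (perm_to_rem xp)))/= leq_addr.
apply: overpartition_eq => n n0.
  rewrite overpartition_of_ov//=; case: leqP => //= nN.
  by apply/negP => /big/=; rewrite leqNgt nN.
rewrite overpartition_of_num//=; case: leqP => //= nN.
apply/eqP; rewrite -leqn0 leqNgt -has_count has_pred1; apply/negP => /big/=.
by rewrite leqNgt nN.
Qed.

Lemma num_le_weight (p : overpartition) n : (0 < n)%N ->
  (num_nonoverlined p n <= weight p)%N.
Proof.
move=> n0; rewrite /num_nonoverlined /weight; elim: (parts p) => //= x s IH.
by apply: leq_add => //; case: eqVneq => // ->.
Qed.

(** * Finite sets of overpartitions and their product formula *)

Section TruncatedOverpartitions.
Variable N : nat.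
Implicit Type f : {ffun 'I_N -> bool * 'I_N.+1}.

(** Index i of the finite function stands for part size i + 1, hence the predecessor; sizes beyond N
    get no copies. *)
Definition ffun_code f (n : nat) : bool * nat :=
  oapp (fun i => ((f i).1, val (f i).2)) (false, 0%N) (insub n.-1).

Lemma ffun_codeE f (i : 'I_N) : ffun_code f i.+1 = ((f i).1, val (f i).2).
Proof. by rewrite /ffun_code /= valK. Qed.

Definition truncated f : overpartition := overpartition_of (ffun_code f) N.

Lemma truncated_ov f (i : 'I_N) : has_overlined (truncated f) i.+1 = (f i).1.
Proof. by rewrite overpartition_of_ov// ltn_ord ffun_codeE. Qed.

Lemma truncated_num f (i : 'I_N) : num_nonoverlined (truncated f) i.+1 = (f i).2.
Proof. by rewrite overpartition_of_num// ltn_ord ffun_codeE. Qed.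

Lemma truncated_weight f :
  weight (truncated f) = (\sum_(i < N) i.+1 * ((f i).1 + (f i).2))%N.
Proof.
rewrite overpartition_of_weight big_mkord; apply: eq_bigr => i _.
by rewrite ffun_codeE.
Qed.

Lemma truncated_inj : injective truncated.
Proof.
move=> f f' e; apply/ffunP => i; apply: injective_projections.
  by rewrite -!truncated_ov e.
by apply: val_inj => /=; rewrite -!truncated_num e.
Qed.

Definition truncated_set : {fset overpartition} :=
  [fset truncated f | f in {: {ffun 'I_N -> bool * 'I_N.+1}}]%fset.

(** The weight bounds both part sizes and multiplicities, so the truncated sets exhaust all
    overpartitions. *)
Lemma truncated_setP (p : overpartition) : (weight p <= N)%N -> p \in truncated_set.
Proof.
move=> pN; apply/imfsetP => /=.
(* [inord] loses nothing here: multiplicities are at most the weight, hence at most N. *)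
exists [ffun i : 'I_N => (has_overlined p i.+1, inord (num_nonoverlined p i.+1))] => //.
rewrite {1}(overpartition_ofE pN); apply: overpartition_eq => n n0.
  rewrite !overpartition_of_ov//; case: (leqP n N) => //= nN.
  by case: n n0 nN => // n _ nN; rewrite (ffun_codeE _ (Ordinal nN)) ffunE.
rewrite !overpartition_of_num//; case: (leqP n N) => //= nN.
case: n n0 nN => // n _ nN; rewrite (ffun_codeE _ (Ordinal nN)) ffunE/= inordK//.
by rewrite ltnS (leq_trans (num_le_weight p _)).
Qed.

(** Distributing the product over the sums yields one term per finite function, that is, per
    truncated overpartition. Where [D] fails at some size, the corresponding factor makes the term
    vanish. *)
Lemma sum_truncated (K : comNzRingType) (q : K) (D : nat -> bool -> nat -> bool) :
  \sum_(p <- truncated_set)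
    (if [forall i : 'I_N, D i.+1 (has_overlined p i.+1) (num_nonoverlined p i.+1)]
     then q ^+ weight p else 0) =
  \prod_(0 <= i < N) \sum_(c : bool * 'I_N.+1)
     (if D i.+1 c.1 c.2 then (q ^+ i.+1) ^+ (c.1 + c.2) else 0).
Proof.
rewrite big_mkord bigA_distr_bigA big_imfset/=; last by move=> f f' _ _; exact: truncated_inj.
rewrite big_enum; apply: eq_bigr => f _.
case: ifPn => [/forallP h|/forallPn[i hi]].
  rewrite truncated_weight expr_sum; apply: eq_bigr => i _.
  by have := h i; rewrite truncated_ov truncated_num => ->; rewrite exprM.
rewrite (bigD1 i)//=; move: hi; rewrite truncated_ov truncated_num => /negbTE ->.
by rewrite mul0r.
Qed.

End TruncatedOverpartitions.

(** * Local description of [Nmes] and [mes] *)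

(** If n < a, then A would divide a - n, which lies strictly between 0 and A. *)
Lemma mod_progression (A a n : nat) : (1 <= a)%N -> (a <= A)%N ->
  (0 < n)%N -> n = a %[mod A] -> exists k, n = (k * A + a)%N.
Proof.
move=> a0 aA n0 e; have [an|na] := leqP a n.
  move/eqP: e; rewrite eqn_mod_dvd// => /dvdnP[k ek]; exists k.
  by rewrite -ek subnK.
move/esym/eqP: e; rewrite eqn_mod_dvd ?(ltnW na)// => /dvdn_leq; lia.
Qed.

Lemma mes_progression (r A a : nat) (p : overpartition) :
  (1 <= a)%N -> (a <= A)%N -> exists k, mes r A a p = (k * A + a)%N.
Proof.
move=> a0 aA; have [[m0 ma _] _] := @mesP r A a p (leq_trans a0 aA).
exact: mod_progression.
Qed.

(** The constraint at a single part size n with overlining bit b and j plain copies; its conjunction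
    over all sizes expresses that p is in [Nmes] with [mes] equal to k A + a. *)
Definition mes_local (r A a k n : nat) (b : bool) (j : nat) : bool :=
  if n == (k * A + a)%N then (j < r.-1)%N
  else (n \in [seq (i * A + a)%N | i <- iota 0 k]) ==> b && (r.-1 <= j)%N.

(** The bound k A + a <= N ensures that every constrained size is tested. Having few plain copies of
    k A + a already gives [mes_cond] there, so [mes] is determined by the failure of [mes_cond] at
    the earlier terms. *)
Lemma Nmes_mesP (r A a k N : nat) (p : overpartition) :
  (1 <= a)%N -> (a <= A)%N -> (k * A + a <= N)%N ->
  (p \in Nmes r A a) && (mes r A a p == k * A + a)%N =
  [forall i : 'I_N, mes_local r A a k i.+1 (has_overlined p i.+1)
                                         (num_nonoverlined p i.+1)].
Proof.
move=> a0 aA kN; have A0 := leq_trans a0 aA.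
have [[m0 ma mcond] mmin] := @mesP r A a p A0.
have prog j : (j * A + a = a %[mod A])%N by rewrite modnMDl.
apply/idP/forallP => [/andP[/set_mem pN /eqP mE] i|h].
  rewrite /mes_local; case: eqVneq => [->|_]; first by rewrite -mE.
  apply/implyP => /mapP[j]; rewrite mem_iota/= add0n => jk ->.
  (* By minimality both alternatives of [mes_cond] fail at an earlier term: the overlined part is
     present and there are at least r - 1 plain copies. *)
  have nc : ~ mes_cond r A a p (j * A + a).
    by move/mmin; rewrite mE leq_add2r leq_pmul2r// leqNgt jk.
  have j0 : (0 < j * A + a)%N by rewrite addn_gt0 a0 orbT.
  apply/andP; split; last by rewrite leqNgt; apply/negP => ?; apply: nc; split=> //; right.
  by apply/negPn/negP => ?; apply: nc; split=> //; left.
have hloc n : (0 < n <= N)%N ->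
    mes_local r A a k n (has_overlined p n) (num_nonoverlined p n).
  by case: n => // n nN; exact: (h (Ordinal nN)).
have hk : (num_nonoverlined p (k * A + a) < r.-1)%N.
  by have := hloc (k * A + a)%N; rewrite /mes_local eqxx kN addn_gt0 a0 orbT; apply.
have mE : mes r A a p = (k * A + a)%N.
  (* One inequality is minimality. For the other, a smaller value j A + a with j < k would
     contradict its local condition. *)
  apply/eqP; rewrite eqn_leq mmin/=; last by split=> //; [rewrite addn_gt0 a0 orbT|right].
  have [j mj] := mod_progression a0 aA m0 ma.
  rewrite mj leq_add2r leq_pmul2r// leqNgt; apply/negP => jk.
  have jm : (j * A + a)%N \in [seq (i * A + a)%N | i <- iota 0 k].
    by apply/mapP; exists j; rewrite ?mem_iota.
  have := hloc (j * A + a)%N; rewrite /mes_local addn_gt0 a0 orbT.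
  rewrite (leq_trans _ kN) ?leq_add2r ?leq_pmul2r ?(ltnW jk)//.
  rewrite eqn_add2r eqn_pmul2r// (ltn_eqF jk) jm => /(_ isT)/andP[ov nu].
  by case: mcond; rewrite mj; [rewrite ov|rewrite ltnNge nu].
by rewrite mE eqxx andbT; apply/mem_set; rewrite /Nmes /= mE.
Qed.

(* Unordered sums as limits along an exhausting sequence *)
#[local] Existing Instance totally_filter.

Section Summation.
Variable K : numFieldType.

Lemma cvg_near_eq (f g : nat -> K) (l : K) :
  (\forall n \near \oo, f n = g n) ->
  f n @[n --> \oo] --> l -> g n @[n --> \oo] --> l.
Proof. by move=> fg; exact: cvg_trans (near_eq_cvg fg). Qed.

Lemma partial_sumE (I : choiceType) (t : I -> K) (A : {fset I}) :
  partial_sum t A = \sum_(i <- A) t i.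
Proof. by rewrite /partial_sum big_seq_fsetE. Qed.

Lemma big_fset_diff (I : choiceType) (t : I -> K) (A B : {fset I}) :
  (B `<=` A)%fset ->
  \sum_(i <- A) t i - \sum_(i <- B) t i = \sum_(i <- (A `\` B)%fset) t i.
Proof.
move=> BA; rewrite (big_fsetID _ (mem B) A)/=.
have -> : [fset x in A | x \in B]%fset = B.
  apply/fsetP => x; rewrite !inE/=; case: (boolP (x \in B)) => [xB|_]; last by rewrite andbF.
  by rewrite (fsubsetP BA).
rewrite addrAC subrr add0r; congr (\sum_(i <- enum_fset _) _).
by apply/fsetP => x; rewrite !inE/= andbC.
Qed.

(** Domination: a finite set A containing F N lies in some F n, so the terms of A outside F N are
    controlled by the difference of two dominating sums, both close to U. *)
Lemma cvg_partial_sum_exhaustion (I : choiceType) (F : nat -> {fset I})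
    (t u : I -> K) (L U : K) :
  (forall i, \forall n \near \oo, i \in F n) ->
  (forall i, `|t i| <= u i) ->
  \sum_(i <- F n) u i @[n --> \oo] --> U ->
  \sum_(i <- F n) t i @[n --> \oo] --> L ->
  partial_sum t @ totally --> L.
Proof.
move=> Fexh tu FU FL; apply/cvgrPdist_lt => e e0.
have e3 : 0 < e / 3 by rewrite divr_gt0.
have [N _ HN] : \forall n \near \oo,
    `|U - \sum_(i <- F n) u i| < e / 3 /\ `|L - \sum_(i <- F n) t i| < e / 3.
  by apply: filterI; [move/cvgrPdist_lt: FU|move/cvgrPdist_lt: FL]; apply.
exists (F N) => // A /= NA; rewrite partial_sumE.
have [M _ HM] : \forall n \near \oo, forall i, i \in A -> i \in F n.
  have : \forall n \near \oo, forall i, i \in (enum_fset A) -> i \in F n.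
    elim: (enum_fset A) => [|i s IH]; first by apply: nearW.
    move: (Fexh i) IH; apply: filterS2 => n Fi Fs j.
    by rewrite inE => /orP[/eqP ->|/Fs].
  by [].
(* Rank M gives the inclusion of A in F n, rank N keeps the dominating sum within e / 3 of U. *)
pose n := maxn N M.
have AF : (A `<=` F n)%fset by apply/fsubsetP/HM; exact: leq_maxr.
have [UN LN] := HN N (leqnn N); have [Un _] := HN n (leq_maxl _ _).
have tail : `|\sum_(i <- A) t i - \sum_(i <- F N) t i| <=
    \sum_(i <- F n) u i - \sum_(i <- F N) u i.
  rewrite !big_fset_diff//; last exact: fsubset_trans NA AF.
  rewrite (le_trans (ler_norm_sum _ _ _))//.
  rewrite (le_trans (ler_sum _ (fun i _ => tu i)))//.
  rewrite -subr_ge0 big_fset_diff ?fsetSD//.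
  by apply: sumr_ge0 => i _; exact: le_trans (tu i).
have -> : e = e / 3 + (e / 3 + e / 3) by field.
rewrite -(subrK (\sum_(i <- F N) t i) L) -addrA.
rewrite (le_lt_trans (ler_normD _ _))// ltrD// distrC (le_lt_trans tail)//.
rewrite -(subrK U (\sum_(i <- F n) u i)) -addrA.
rewrite -[X in X < _]ger0_norm; last first.
  by rewrite addrA subrK (le_trans _ tail).
by rewrite (le_lt_trans (ler_normD _ _))// ltrD// distrC.
Qed.

Lemma cvg_partial_sum_single (I : choiceType) (t : I -> K) (k : I) :
  (forall i, i != k -> t i = 0) -> partial_sum t @ totally --> t k.
Proof.
move=> tk; apply: cvg_near_cst; exists [fset k]%fset => // A /= kA.
rewrite partial_sumE (big_fsetD1 k)/=; last by rewrite -fsub1set.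
rewrite big_seq big1 ?addr0// => i; rewrite !inE => /andP[ik _]; exact: tk.
Qed.

Lemma zcoef_cvg (I : choiceType) (D : set I) e (c : I -> K) m (l : K) :
  partial_sum (zterm D e c m) @ totally --> l -> zcoef D e c m = l.
Proof. exact: norm_cvg_lim. Qed.

Lemma zterm_eq0_cvg (I : choiceType) (D : set I) e (c : I -> K) m :
  (forall i, e i != m) -> partial_sum (zterm D e c m) @ totally --> (0 : K).
Proof.
move=> em; apply: cvg_near_cst; apply: nearW => A.
by rewrite partial_sumE big1// => i _; rewrite /zterm (negbTE (em i)) andbF.
Qed.

End Summation.

(** * Limits of the factors attached to part sizes and of their products *)

Section GeneratingFunctions.
Variables (K : numFieldType) (q : K).
Hypotheses (Kcomplete : geom_complete K) (q1 : `|q| < 1).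

Let qX n : (0 < n)%N -> `|q ^+ n| < 1.
Proof. by move=> n0; rewrite normrX exprn_ilt1// -lt0n. Qed.

Let nz_1Bq n : (0 < n)%N -> 1 - q ^+ n != 0.
Proof. by move=> /qX; exact: norm_lt1_subr_neq0. Qed.

Let nz_1Dq n : (0 < n)%N -> 1 + q ^+ n != 0.
Proof.
by move=> /qX qn; rewrite -[q ^+ n]opprK norm_lt1_subr_neq0// normrN.
Qed.

(** The factor of part size n in the truncated generating function: plain multiplicities run up to
    N, subject to [D]. *)
Definition part_series (D : nat -> bool -> nat -> bool) (N n : nat) : K :=
  \sum_(c : bool * 'I_N.+1) (if D n c.1 c.2 then (q ^+ n) ^+ (c.1 + c.2) else 0).

Lemma part_seriesE D N n : part_series D N n =
  q ^+ n * (\sum_(0 <= j < N.+1 | D n true j) (q ^+ n) ^+ j)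
  + \sum_(0 <= j < N.+1 | D n false j) (q ^+ n) ^+ j.
Proof.
rewrite /part_series -(pair_bigA _ (fun (b : bool) (j : 'I_N.+1) =>
  if D n b j then (q ^+ n) ^+ (b + j) else 0))/= big_bool/= -!big_mkcond/=.
by rewrite !big_mkord mulr_sumr; congr (_ + _); apply: eq_bigr => j _; rewrite ?exprS.
Qed.

Lemma part_series_all N n : part_series (fun _ _ _ => true) N n =
  (1 + q ^+ n) * \sum_(0 <= j < N.+1) (q ^+ n) ^+ j.
Proof. by rewrite part_seriesE mulrDl mul1r addrC. Qed.

Lemma part_series_all_neq0 N n : (0 < n)%N ->
  part_series (fun _ _ _ => true) N n != 0.
Proof.
move=> n0; rewrite part_series_all geom_sumE ?qX// !mulf_neq0// ?invr_eq0 ?nz_1Dq ?nz_1Bq//.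
by rewrite -exprM nz_1Bq// muln_gt0 n0.
Qed.

Lemma cvg_part_series_all n : (0 < n)%N ->
  part_series (fun _ _ _ => true) N n @[N --> \oo] --> (1 + q ^+ n) / (1 - q ^+ n).
Proof.
move=> n0; under eq_cvg do rewrite part_series_all.
apply: cvgMr; have := cvg_geom_sum Kcomplete (qX n0).
by rewrite -(cvg_shiftS (fun N => \sum_(0 <= j < N) (q ^+ n) ^+ j)).
Qed.

(** The geometric sums turn the finite product into a quotient of partial q-Pochhammer products
    times a truncation factor tending to 1. *)
Lemma cvg_prod_part_series_all :
  \prod_(0 <= i < N) part_series (fun _ _ _ => true) N i.+1 @[N --> \oo] -->
  qpoch_inf (- q) q / qpoch_inf q q.
Proof.
have [_ hN] := cvg_qpoch_inf Kcomplete (etrans (congr1 (fun x => x < 1) (normrN q)) q1) q1.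
have [nz hq] := cvg_qpoch_inf Kcomplete q1 q1.
have h : \prod_(0 <= i < N) (1 - - q * q ^+ i) / \prod_(0 <= i < N) (1 - q * q ^+ i) *
    \prod_(0 <= i < N) (1 - (q ^+ i.+1) ^+ N.+1) @[N --> \oo] -->
    qpoch_inf (- q) q / qpoch_inf q q * 1.
  apply: cvgM (cvg_prod_truncation Kcomplete q1); apply: cvgM => //.
  exact: cvgV.
rewrite mulr1 in h; apply: (cvg_near_eq _ h); apply: nearW => N.
rewrite -prodfV -!big_split/=; apply: eq_bigr => i _.
by rewrite part_series_all geom_sumE ?qX// mulNr opprK -!exprS mulrA mulrAC.
Qed.

(** Outside the finite list s the factors are the unconstrained ones. The product is thus the full
    product times finitely many quotients, the one at n tending to l n. *)
Lemma cvg_prod_part_series (D : nat -> bool -> nat -> bool) (s : seq nat)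
    (l : nat -> K) :
  uniq s -> all (leq 1) s -> (forall n b j, n \notin s -> D n b j) ->
  (forall n, n \in s -> part_series D N n @[N --> \oo] -->
     l n * ((1 + q ^+ n) / (1 - q ^+ n))) ->
  \prod_(0 <= i < N) part_series D N i.+1 @[N --> \oo] -->
  qpoch_inf (- q) q / qpoch_inf q q * \prod_(n <- s) l n.
Proof.
move=> us /allP s0 Ds hl.
pose full := part_series (fun _ _ _ => true).
have hs : \prod_(n <- s) (part_series D N n / full N n) @[N --> \oo] -->
    \prod_(n <- s) l n.
  (* The test lets [cvg_prod_seq], which asks for a limit at every index, apply to factors
     controlled only on s. *)
  have : \prod_(n <- s) (if n \in s then part_series D N n / full N n else 1)
      @[N --> \oo] --> \prod_(n <- s) (if n \in s then l n else 1).
    apply: cvg_prod_seq => n; case: ifPn => [ns|_]; last exact: cvg_cst.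
    have n0 := s0 _ ns.
    have nz : (1 + q ^+ n) / (1 - q ^+ n) != 0.
      by rewrite mulf_neq0 ?invr_eq0 ?nz_1Dq ?nz_1Bq.
    rewrite -[X in _ --> X](mulfK nz); apply: cvgM; first exact: hl.
    by apply: cvgV => //; exact: cvg_part_series_all.
  have e (f : nat -> K) : \prod_(n <- s) (if n \in s then f n else 1) = \prod_(n <- s) f n.
    by rewrite big_seq [RHS]big_seq; apply: eq_bigr => n ->.
  by rewrite e; under eq_cvg do rewrite e.
have h : \prod_(0 <= i < N) full N i.+1 *
    \prod_(n <- s) (part_series D N n / full N n) @[N --> \oo] -->
    qpoch_inf (- q) q / qpoch_inf q q * \prod_(n <- s) l n.
  exact: cvgM cvg_prod_part_series_all hs.
apply: (cvg_near_eq _ h).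
(* Once N reaches the largest element of s, the quotients over s equal those over all sizes up to N,
   the others being 1. *)
exists (\max_(n <- s) n)%N => // N /= sN.
have -> : \prod_(n <- s) (part_series D N n / full N n) =
    \prod_(0 <= i < N) (part_series D N i.+1 / full N i.+1).
  transitivity (\prod_(1 <= n < N.+1) (part_series D N n / full N n)); last first.
    by rewrite big_add1.
  rewrite [RHS](bigID (mem s))/= [X in _ = _ * X]big1_seq ?mulr1; last first.
    move=> n /andP[ns]; rewrite mem_index_iota => /andP[n0 _].
    rewrite (_ : part_series D N n = full N n) ?divff ?part_series_all_neq0//.
    by apply: eq_bigr => c _; rewrite Ds.
  rewrite -[RHS]big_filter; apply: perm_big; apply: uniq_perm => //.
    by rewrite filter_uniq// iota_uniq.
  move=> n; rewrite mem_filter mem_index_iota ltnS /=.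
  case: (boolP (n \in s)) => //= ns; rewrite (s0 _ ns)/=; apply/esym.
  by apply: leq_trans sN; rewrite (big_rem n)//= leq_maxl.
rewrite -big_split/=; apply: eq_bigr => i _.
by rewrite mulrCA divff ?mulr1// part_series_all_neq0.
Qed.

(** With x = q^n, the overlined copy gives x and the plain copies the tail x^(r-1) / (1 - x); the
    limit x^r / (1 - x) is written as a multiple of the unconstrained factor. *)
Lemma cvg_part_series_both (D : nat -> bool -> nat -> bool) (r n : nat) :
  (0 < r)%N -> (0 < n)%N -> (forall b j, D n b j = b && (r.-1 <= j)%N) ->
  part_series D N n @[N --> \oo] -->
  q ^+ (r * n) / (1 + q ^+ n) * ((1 + q ^+ n) / (1 - q ^+ n)).
Proof.
move=> r0 n0 Dn; have := cvg_geom_sum Kcomplete (qX n0).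
rewrite -(cvg_shiftS (fun N => \sum_(0 <= j < N) (q ^+ n) ^+ j)) => h.
have : q ^+ n * (\sum_(0 <= j < N.+1) (q ^+ n) ^+ j -
      \sum_(0 <= j < r.-1) (q ^+ n) ^+ j) @[N --> \oo] -->
    q ^+ n * ((1 - q ^+ n)^-1 - \sum_(0 <= j < r.-1) (q ^+ n) ^+ j).
  by apply: cvgMr; apply: cvgB => //; exact: cvg_cst.
have -> : q ^+ n * ((1 - q ^+ n)^-1 - \sum_(0 <= j < r.-1) (q ^+ n) ^+ j) =
    q ^+ (r * n) / (1 + q ^+ n) * ((1 + q ^+ n) / (1 - q ^+ n)).
  rewrite geom_sumE ?qX// mulnC exprM -(prednK r0) [RHS]mulrA mulfVK ?nz_1Dq// exprS /=.
  by rewrite -[X in X - _]mul1r -mulrBl opprB addrC subrK mulrA.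
move=> {}h; apply: (cvg_near_eq _ h); exists r => // N /= rN.
rewrite part_seriesE [X in _ = _ + X]big1 ?addr0; last by move=> j; rewrite Dn.
congr (_ * _); rewrite (big_cat_nat (n := r.-1))//=; last by lia.
rewrite addrAC subrr add0r [RHS](big_cat_nat (n := r.-1))//=; last by lia.
rewrite [X in _ = X + _]big_nat_cond [X in _ = X + _]big1 ?add0r; last first.
  by move=> j; rewrite Dn; lia.
rewrite [LHS]big_nat_cond [RHS]big_nat_cond; apply: eq_bigl => j.
by rewrite Dn; lia.
Qed.

(** The factor is constant once N >= r: both overlining choices give the geometric sum of r terms.
    Here r is the strict bound itself, so it is instantiated later with [r.-1]. *)
Lemma cvg_part_series_few (D : nat -> bool -> nat -> bool) (r n : nat) :
  (0 < n)%N -> (forall b j, D n b j = (j < r)%N) ->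
  part_series D N n @[N --> \oo] -->
  (1 - q ^+ (r * n)) * ((1 + q ^+ n) / (1 - q ^+ n)).
Proof.
move=> n0 Dn; apply: cvg_near_cst; exists r => // N /= rN.
have e b : \sum_(0 <= j < N.+1 | D n b j) (q ^+ n) ^+ j =
    (1 - q ^+ (r * n)) / (1 - q ^+ n).
  rewrite mulnC exprM -geom_sumE ?qX// (big_cat_nat (n := r))//=; last by lia.
  rewrite [X in _ + X]big_nat_cond [X in _ + X]big1 ?addr0; last first.
    by move=> j; rewrite Dn; lia.
  rewrite [LHS]big_nat_cond [RHS]big_nat_cond; apply: eq_bigl => j.
  by rewrite Dn; lia.
by rewrite part_seriesE !e -[X in _ + X]mul1r -mulrDl addrC mulrCA.
Qed.

End GeneratingFunctions.

(** * The generating function of [Nmes] *)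

(** Explains the exponent in the theorem: it is r times the sum of the first k terms of the
    progression. *)
Lemma sum_progression (A a k : nat) :
  (\sum_(0 <= i < k) (i * A + a) = A * 'C(k, 2) + k * a)%N.
Proof.
elim: k => [|k IH]; first by rewrite big_geq// muln0.
by rewrite big_nat_recr//= IH binS bin1; lia.
Qed.

Section NmesGeneratingFunction.
Variables (K : numFieldType) (q : K) (A a r : nat).
Hypotheses (Kcomplete : geom_complete K) (q1 : `|q| < 1).
Hypotheses (a0 : (1 <= a)%N) (aA : (a <= A)%N) (r2 : (2 <= r)%N).

Definition Nmes_coef (k : nat) : K :=
  q ^+ (r * (A * 'C(k, 2) + k * a)) / qpoch (- q ^+ a) (q ^+ A) k
  - q ^+ (r * (A * 'C(k, 2) + k * a) + r.-1 * (k * A + a))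
      / qpoch (- q ^+ a) (q ^+ A) k.

(** Factoring out the common quotient leaves 1 - q^((r-1)(k A + a)); the quotient then splits into
    one factor for each of the first k terms of the progression. *)
Lemma Nmes_coefE k : Nmes_coef k =
  \prod_(0 <= i < k) (q ^+ (r * (i * A + a)) / (1 + q ^+ (i * A + a))) *
  (1 - q ^+ (r.-1 * (k * A + a))).
Proof.
have qX n : (0 < n)%N -> `|q ^+ n| < 1.
  by move=> n0; rewrite normrX exprn_ilt1// -lt0n.
rewrite /Nmes_coef qpochE ?normrN ?qX ?(leq_trans a0)// exprD -mulrBl.
rewrite -[X in X - _]mulr1 -mulrBr mulrAC; congr (_ * _).
rewrite -sum_progression big_distrr expr_sum -prodfV -big_split/=.
apply: eq_bigr => i _; congr (_ / _).
by rewrite mulNr opprK -exprM -exprD addnC [(A * i)%N]mulnC.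
Qed.

Let base k : seq nat := [seq (i * A + a)%N | i <- iota 0 k].

Lemma cvg_Nmes_truncated k :
  \prod_(0 <= i < N) part_series q (mes_local r A a k) N i.+1 @[N --> \oo] -->
  qpoch_inf (- q) q / qpoch_inf q q * Nmes_coef k.
Proof.
have A0 := leq_trans a0 aA.
pose m := (k * A + a)%N.
pose l (n : nat) : K := if n == m then 1 - q ^+ (r.-1 * m)
  else q ^+ (r * n) / (1 + q ^+ n).
have inj : injective (fun i => (i * A + a)%N).
  by move=> i j /eqP; rewrite eqn_add2r eqn_pmul2r// => /eqP.
have mb : m \notin base k.
  by rewrite /base; apply/mapP => -[j]; rewrite mem_iota => jk /inj kj; move: jk; rewrite kj; lia.
(* The constrained sizes are the terms of index below k followed by m, each contributing its
   correction l. *)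
have -> : Nmes_coef k = \prod_(n <- rcons (base k) m) l n.
  rewrite big_rcons/= {2}/l eqxx Nmes_coefE; congr (_ * _).
  rewrite big_map /index_iota subn0 big_seq [RHS]big_seq; apply: eq_bigr => i ik.
  rewrite /l ifN//; apply: contraNneq mb => <-; exact: map_f.
apply: cvg_prod_part_series => //.
- by rewrite rcons_uniq mb map_inj_uniq ?iota_uniq.
- rewrite all_rcons; apply/andP; split; first by rewrite addn_gt0 a0 orbT.
  by rewrite /base; apply/allP => n /mapP[j _ ->]; rewrite addn_gt0 a0 orbT.
- move=> n b j; rewrite mem_rcons inE negb_or /mes_local => /andP[/negbTE -> nb].
  by rewrite (negbTE nb).
move=> n; rewrite mem_rcons inE /l; case: eqVneq => [-> _|nm /= nb].
  apply: cvg_part_series_few => //; first by rewrite addn_gt0 a0 orbT.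
  by move=> b j; rewrite /mes_local eqxx.
apply: cvg_part_series_both => //; first exact: ltnW.
  by move: nb; rewrite /base => /mapP[j _ ->]; rewrite addn_gt0 a0 orbT.
by move=> b j; rewrite /mes_local (negbTE nm) -/(base k) nb.
Qed.

(** The truncated sets serve as exhaustion, and |q|^weight dominates, its sums converging by the
    unconstrained product at |q|. *)
Lemma cvg_Nmes_partial_sum k :
  partial_sum (zterm (Nmes r A a) (mes r A a) (fun p => q ^+ weight p) (k * A + a))
    @ totally --> qpoch_inf (- q) q / qpoch_inf q q * Nmes_coef k.
Proof.
apply: (@cvg_partial_sum_exhaustion _ _ truncated_set _ (fun p => `|q| ^+ weight p) _
  (qpoch_inf (- `|q|) `|q| / qpoch_inf `|q| `|q|)).
- by move=> p; exists (weight p) => // N /= pN; exact: truncated_setP.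
- by move=> p; rewrite /zterm; case: ifP; rewrite ?normr0 ?exprn_ge0// normrX.
- have q1' : `| `|q| | < 1 by rewrite normr_id.
  apply: cvg_near_eq (cvg_prod_part_series_all Kcomplete q1').
  apply: nearW => N.
  rewrite /part_series -(sum_truncated N `|q| (fun _ _ _ => true)); apply: eq_bigr => p _.
  by rewrite ifT//; apply/forallP.
have h := @cvg_Nmes_truncated k.
apply: (cvg_near_eq _ h).
exists (k * A + a)%N => // N /= kN; rewrite /part_series -sum_truncated.
by apply: eq_bigr => p _; rewrite /zterm (Nmes_mesP _ _ a0 aA kN).
Qed.

(** Coefficients are compared one m at a time: at most one k satisfies m = k A + a, and if none
    does, both sums have only zero terms. *)
Lemma Nmes_generating_function :
  zconvergent (Nmes r A a) (mes r A a) (fun p => q ^+ weight p) /\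
  forall m, zcoef (Nmes r A a) (mes r A a) (fun p => q ^+ weight p) m =
    qpoch_inf (- q) q / qpoch_inf q q *
    zcoef [set: nat] (fun k => k * A + a)%N Nmes_coef m.
Proof.
suff H m : exists l, partial_sum
      (zterm (Nmes r A a) (mes r A a) (fun p => q ^+ weight p) m) @ totally -->
      qpoch_inf (- q) q / qpoch_inf q q * l /\
    partial_sum (zterm [set: nat] (fun k => k * A + a)%N Nmes_coef m) @ totally --> l.
  split=> m; have [l [h1 h2]] := H m.
    by apply/cvg_ex; eexists; exact: h1.
  by rewrite (zcoef_cvg h1) (zcoef_cvg h2).
have A0 := leq_trans a0 aA.
have [[k ->]|nk] := pselect (exists k, m = (k * A + a)%N); last first.
  exists 0; rewrite mulr0; split; apply: zterm_eq0_cvg; [move=> p|move=> k].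
    have [k ->] := mes_progression r p a0 aA.
    by apply/eqP => e; apply: nk; exists k.
  by apply/eqP => e; apply: nk; exists k.
exists (Nmes_coef k); split; first exact: cvg_Nmes_partial_sum.
have -> : Nmes_coef k =
    zterm [set: nat] (fun k => k * A + a)%N Nmes_coef (k * A + a) k.
  by rewrite /zterm in_setT eqxx.
apply: cvg_partial_sum_single => i ik.
by rewrite /zterm eqn_add2r eqn_pmul2r// (negbTE ik) andbF.
Qed.

End NmesGeneratingFunction.

(** * Completeness of the complex numbers for geometric increments *)

(** The telescoping series converges absolutely by comparison with a geometric series. *)
Lemma cvg_geom_increments (R : realType) (c y : R) (v : nat -> R) :
  0 <= y -> y < 1 -> (forall n, `|v n.+1 - v n| <= c * y ^+ n) ->
  exists l : R, v n @[n --> \oo] --> l.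
Proof.
move=> y0 y1 vc.
have c0 : 0 <= c by have := vc 0; rewrite expr0 mulr1; apply: le_trans.
have /cvg_ex[/= l hl] : cvgn (series (telescope v)).
  apply: normed_cvg; apply: (@series_le_cvg _ _ (geometric c y)).
  - by move=> n; exact: normr_ge0.
  - by move=> n; rewrite /geometric/= mulr_ge0// exprn_ge0.
  - exact: vc.
  - by apply: is_cvg_geometric_series; rewrite ger0_norm.
exists (v 0 + l).
have h : v 0 + series (telescope v) n @[n --> \oo] --> v 0 + l.
  by apply: cvgD; [exact: cvg_cst|exact: hl].
by apply: (cvg_near_eq _ h); apply: nearW => n; rewrite -eq_sum_telescope.
Qed.

(** Real and imaginary parts inherit the increment bound, so the real case applies to each. *)
Lemma complex_geom_complete (R : realType) : geom_complete (R[i] : numFieldType).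
Proof.
move=> C x u x0 x1 hu.
have C0 : 0 <= C by have := hu 0; rewrite expr0 mulr1; apply: le_trans.
(* In the partial order of [R[i]], a nonnegative element is real; this brings C, x and the tolerance
   e down to R. *)
have realE (z : R[i]) : 0 <= z -> z = (complex.Re z)%:C.
  by case: z => s t; rewrite lecE/= => /andP[/eqP -> _].
have norm_Im (z : R[i]) : `|complex.Im z|%:C <= `|z|.
  by case: z => s t; rewrite normc_def lecR -sqrtr_sqr ler_wsqrtr//= lerDr sqr_ge0.
have hR n : `|complex.Re (u n.+1) - complex.Re (u n)| <=
    complex.Re C * complex.Re x ^+ n.
  rewrite -lecR rmorphM rmorphXn/= -!realE//; apply: le_trans (hu n).
  by apply: le_trans (normc_ge_Re _); rewrite raddfB.
have hI n : `|complex.Im (u n.+1) - complex.Im (u n)| <=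
    complex.Re C * complex.Re x ^+ n.
  rewrite -lecR rmorphM rmorphXn/= -!realE//; apply: le_trans (hu n).
  by apply: le_trans (norm_Im _); rewrite raddfB.
have y0 : 0 <= complex.Re x by rewrite -lecR -realE.
have y1 : complex.Re x < 1 by rewrite -ltcR -realE.
have [s hs] := cvg_geom_increments y0 y1 hR.
have [t ht] := cvg_geom_increments y0 y1 hI.
exists (s +i* t); apply/cvgrPdist_lt => e e0.
have eE := realE _ (ltW e0).
(* Half of the tolerance goes to each of the two coordinates. *)
have e2 : 0 < complex.Re e / 2 by rewrite divr_gt0// -ltcR -eE.
move/cvgrPdist_lt: hs => /(_ _ e2) hs; move/cvgrPdist_lt: ht => /(_ _ e2) ht.
move: hs ht; apply: filterS2 => n hs ht.
have -> : (s +i* t) - u n =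
  (s - complex.Re (u n))%:C + 'i%C * (t - complex.Im (u n))%:C.
  by case: (u n) => s' t'; simpc.
have norm_real (w : R) : `|w%:C| = `|w|%:C.
  by rewrite normc_def/= expr0n/= addr0 sqrtr_sqr.
have norm_i : `|'i%C : R[i]| = 1.
  by rewrite normc_def/= expr0n/= add0r expr1n sqrtr1.
rewrite eE [complex.Re e]splitr [X in _ < X]rmorphD/=.
by rewrite (le_lt_trans (ler_normD _ _))// normrM norm_i mul1r !norm_real ltrD// ltcR.
Qed.

Unset Implicit Arguments.

Theorem theorem2p7 (R : realType) (q : R[i]) (hq : `|q| < 1)
    (A a r : nat) (ha : (1 <= a)%N) (haA : (a <= A)%N) (hr : (2 <= r)%N) :
  let lhs := zcoef (Nmes r A a) (mes r A a) (fun p => q ^+ weight p) in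
  let rhs := zcoef [set: nat] (fun k => k * A + a)%N
    (fun k =>
       q ^+ (r * (A * 'C(k, 2) + k * a)) / qpoch (- q ^+ a) (q ^+ A) k
       - q ^+ (r * (A * 'C(k, 2) + k * a) + r.-1 * (k * A + a))
           / qpoch (- q ^+ a) (q ^+ A) k) in
  zconvergent (Nmes r A a) (mes r A a) (fun p => q ^+ weight p) /\
  forall m : nat, lhs m = qpoch_inf (- q) q / qpoch_inf q q * rhs m.
Proof. exact: (Nmes_generating_function (@complex_geom_complete R) hq ha haA hr). Qed.
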